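(* Let $1\le \kappa<K\le N$ be integers, and let $d^*_K$ and $d^*_\kappa$ be the optimal thresholds in the Best-1 case of the Sliding-Window Secretary Problem with $N$ applicants for window sizes $K$ and $\kappa$, respectively. Then $$\Pr(\mathrm{Win}\mid \kappa, d^*_\kappa)<\Pr(\mathrm{Win}\mid K,d^*_K).$$
   Context: Setting (Best-1 case with window size $K$). There are $N$ applicants, seen in the order of their indices $1,\dots,N$. $R$ is a uniformly random permutation of $\{1,\dots,N\}$; $R(m)$ is the absolute rank of the applicant at index $m$, with $1$ the best rank. The interviewer observes only relative ranks of the applicants seen so far. When the window starts at index $i$, it consists of applicants $i,\dots,\min(i+K-1,N)$, and exactly the applicants $1,\dots,\min(i+K-1,N)$ have been seen. The interviewer may then choose any applicant in the window (ending the process) or reject applicant $i$ and move the window to start at $i+1$; rejected applicants cannot be recalled. One applicant can be chosen, and the interviewer wins iff that applicant has rank $1$. Under the sliding rule (advance the window until a candidate is at its smallest index), applicant $i$ is a candidate iff $R(i)=\min\{R(1),\dots,R(\min(i+K-1,N))\}$. The threshold strategy with threshold $d$ rejects the first $d$ applicants and chooses the first index $i>d$ such that applicant $i$ is a candidate. $\Pr(\mathrm{Win}\mid K,d)$ is the probability of winning with this strategy for window size $K$. Optimal threshold: $d^*_K+1$ is the smallest index $i$ such that $\Pr(\mathrm{Win}\mid\text{Choosing Candidate } i)>\Pr(\mathrm{Win}\mid\text{Rejecting Candidate } i)$, where both probabilities are conditional on applicant $i$ being a candidate with the window (of size $K$) starting at $i$, and after a rejection the interviewer continues optimally. The threshold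 strategy with threshold $d^*_K$ is the optimal strategy for window size $K$. *)

(* Defs.v *)
From mathcomp Require Import all_boot all_order all_algebra all_fingroup.

Set Implicit Arguments.
Unset Strict Implicit.
Unset Printing Implicit Defensive.

Import Order.TTheory GRing.Theory Num.Theory.
Local Open Scope ring_scope.

(* Everything is numbered from 0: 'I_N is {0, ..., N-1}, the applicant at      *)
(* index m is the ordinal of value m - 1, and absolute rank r is the value     *)
(* r - 1, so that the best rank is 0.  The window starting at w consists of    *)
(* the j : 'I_N with w <= j < w + K; the bound j < N of the type accounts for  *)
(* the truncation min(w + K, N).                                               *)

Definition Pr N (E : {set 'S_N}) : rat := #|E|%:R / #|[set: 'S_N]|%:R.

Definition condPr N (E F : {set 'S_N}) : rat := Pr (E :&: F) / Pr F.

Definition same_relative_ranks N (m : nat) (R R' : 'S_N) : bool :=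
  [forall j : 'I_N, forall k : 'I_N,
     (j < m)%N && (k < m)%N ==> ((R j < R k)%N == (R' j < R' k)%N)].

(* s w R is the decision taken under R when the window starts at w:            *)
(* [Some j] chooses applicant j, [None] rejects w and slides the window.       *)
Definition strategy N := {ffun 'I_N -> {ffun 'S_N -> option 'I_N}}.

(* The applicant chosen must lie in the window, and the decision may depend    *)
(* on R only through the relative ranks of the applicants seen so far.         *)
Definition admissible N (K : nat) (s : strategy N) : bool :=
  [forall w : 'I_N, forall R : 'S_N,
     (if s w R is Some j then (w <= j < w + K)%N else true) &&
     [forall R' : 'S_N,
        same_relative_ranks (w + K) R R' ==> (s w R == s w R')]].

(* The applicant finally chosen when the process is run from the window        *)
(* starting at w0; [None] if everybody is rejected.                            *)
Definition chosen N (s : strategy N) (w0 : nat) (R : 'S_N) : option 'I_N :=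
  ohead (pmap (fun w : 'I_N => s w R) [seq w : 'I_N <- enum 'I_N | (w0 <= w)%N]).

Definition win N (s : strategy N) (w0 : nat) : {set 'S_N} :=
  [set R : 'S_N | if chosen s w0 R is Some j then R j == 0%N :> nat else false].

Definition candidate N (K : nat) (i : 'I_N) (R : 'S_N) : bool :=
  [forall j : 'I_N, (j < i + K)%N ==> (R i <= R j)%N].

Definition candidate_event N (K : nat) (i : 'I_N) : {set 'S_N} :=
  [set R : 'S_N | candidate K i R].

Definition threshold_strategy N (K d : nat) : strategy N :=
  [ffun i : 'I_N => [ffun R : 'S_N =>
     if (d <= i)%N && candidate K i R then Some i else None]].

Definition Pr_win N (K d : nat) : rat := Pr (win (threshold_strategy N K d) 0).

Definition Pr_win_choosing N (K : nat) (i : 'I_N) : rat :=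
  condPr [set R : 'S_N | R i == 0%N :> nat] (candidate_event K i).

(* Optimal continuation: the maximum is over all admissible strategies, not    *)
(* only threshold ones, run from the window following the one starting at i.   *)
Definition Pr_win_rejecting N (K : nat) (i : 'I_N) : rat :=
  \big[Num.max/0]_(s : strategy N | admissible K s)
     condPr (win s i.+1) (candidate_event K i).

(* Because of the numbering from 0, the optimal threshold (one less than the   *)
(* smallest such index counted from 1) is the smallest such ordinal itself.    *)
Definition optimal_threshold N (K : nat) (d : 'I_N) : Prop :=
  Pr_win_choosing K d > Pr_win_rejecting K d /\
  forall i : 'I_N, Pr_win_choosing K i > Pr_win_rejecting K i -> (d <= i)%N.

Lemma optimal_threshold_unique N (K : nat) (d d' : 'I_N) :
  optimal_threshold K d -> optimal_threshold K d' -> d = d'.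
Proof.
move=> [d1 dmin] [d1' dmin']; apply/val_inj/eqP.
by rewrite eqn_leq dmin //= dmin'.
Qed.

Lemma optimal_threshold_exists N (K : nat) :
  (0 < K)%N -> (0 < N)%N -> exists d : 'I_N, optimal_threshold K d.
Proof.
case: N => // n K_gt0 _; pose l : 'I_n.+1 := ord_max.
have win0 s : win s l.+1 = set0 :> {set 'S_n.+1}.
  apply/setP => R; rewrite !inE /chosen.
  suff -> : [seq w : 'I_n.+1 <- enum 'I_n.+1 | (l.+1 <= w)%N] = [::] by [].
  by rewrite (eq_filter (a2 := pred0)) ?filter_pred0 // => w /=; rewrite ltnNge -ltnS ltn_ord.
have rej0 : Pr_win_rejecting K l = 0.
  rewrite /Pr_win_rejecting; elim/big_ind: _ => // [x y -> -> | s _].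
    by rewrite maxxx.
  by rewrite win0 /condPr set0I /Pr cards0 !mul0r.
have candE : candidate_event K l = [set R : 'S_n.+1 | R l == 0%N :> nat].
  apply/setP => R; rewrite !inE; apply/forallP/eqP => [h | -> j]; last by rewrite implybT.
  have := h ((R^-1)%g ord0); rewrite permKV leqn0 => /implyP/(_ _)/eqP; apply.
  by rewrite (leq_trans (ltn_ord _)) //= -addn1 leq_add2l.
have cand_gt0 : 0 < Pr (candidate_event K l).
  rewrite /Pr divr_gt0 // ltr0n card_gt0; apply/set0Pn; last by exists 1%g; rewrite inE.
  by exists (tperm l ord0); rewrite candE inE tpermL.
have ex : exists i : 'I_n.+1, Pr_win_choosing K i > Pr_win_rejecting K i.
  by exists l; rewrite rej0 /Pr_win_choosing -candE /condPr setIid divff // gt_eqF.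
case: ex => i0 Pi0.
by case: (arg_minnP (P := fun i : 'I_n.+1 => Pr_win_choosing K i > Pr_win_rejecting K i) val Pi0) => d; exists d.
Qed.

(* Main.v *)
(* Whatever the strategy, let x_j be the probability that applicant j is chosen
   while being a candidate.  Being a candidate at j is independent of the
   relative ranks of the applicants before j, and no other applicant of
   (j - K, j) can be a candidate if j is, so that, with n_j = min(j + K, N),
     x_j <= (1 - sum_(l <= j - K) x_l) / n_j,
   while the probability of winning is sum_j (n_j / N) x_j.  The dual of this
   linear program is solved by backward recursion, and the threshold strategy
   with the optimal threshold attains the dual bound: it is at least as good as
   every other threshold strategy.  It remains to beat the threshold d with
   window kappa by some threshold with window K.  If d + kappa < N the same
   threshold d does, since fewer false alarms precede the best applicant: a candidate
   for K is a candidate for kappa, but not conversely; otherwise N - K does, as it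
   always wins when the best applicant comes at or after N - K < d. *)
Require Import Defs.
From mathcomp Require Import all_boot all_order all_algebra all_fingroup.
From mathcomp Require Import zify ring.
Import Order.TTheory GRing.Theory Num.Theory.
Local Open Scope ring_scope.
Set Implicit Arguments.
Unset Strict Implicit.
Unset Printing Implicit Defensive.

(** * Uniform probability on permutations *)

Section Probability.
Variable N : nat.
Implicit Types (E F G : {set 'S_N}) (R : 'S_N).

Lemma card_perm_gt0 : 0 < #|[set: 'S_N]|%:R :> rat.
Proof. by rewrite ltr0n; apply/card_gt0P; exists 1%g; rewrite inE. Qed.

Lemma Pr_ge0 E : 0 <= Pr E.
Proof. by rewrite divr_ge0. Qed.

Lemma Pr_setT : Pr [set: 'S_N] = 1.
Proof. by rewrite /Pr divff // gt_eqF ?card_perm_gt0. Qed.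

Lemma Pr_set0 : Pr (set0 : {set 'S_N}) = 0.
Proof. by rewrite /Pr cards0 mul0r. Qed.

Lemma Pr_subset E F : E \subset F -> Pr E <= Pr F.
Proof.
by move=> /subset_leq_card EF; rewrite ler_pM2r ?ler_nat // invr_gt0 card_perm_gt0.
Qed.

Lemma Pr_proper E F : E \proper F -> Pr E < Pr F.
Proof.
by move=> /proper_card EF; rewrite ltr_pM2r ?ltr_nat // invr_gt0 card_perm_gt0.
Qed.

Lemma Pr_setID E F : Pr E = Pr (E :&: F) + Pr (E :\: F).
Proof. by rewrite /Pr -mulrDl -natrD cardsID. Qed.

Lemma Pr_partition (I : finType) (P : pred I) (A : I -> {set 'S_N}) E :
    (forall R, R \in E -> exists2 i, P i & R \in A i) ->
    (forall i, P i -> A i \subset E) ->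
    (forall R i j, R \in A i -> R \in A j -> i = j) ->
  Pr E = \sum_(i | P i) Pr (A i).
Proof.
move=> cov sub disj; rewrite /Pr -mulr_suml -natr_sum; congr (_%:R / _).
rewrite -sum1_card.
under [RHS]eq_bigr do rewrite -sum1_card.
rewrite (exchange_big_dep (mem E)) /=; last first.
  by move=> i R Pi /(subsetP (sub i Pi)).
apply: eq_bigr => R ER; have [i Pi Ai] := cov R ER.
rewrite (big_pred1 i) // => j /=.
by apply/andP/eqP => [[_ Aj] | -> //]; apply: disj Aj Ai.
Qed.

(** * Events determined by the relative ranks of the first applicants *)

(** Membership in the sigma-algebra generated by the relative ranks of the first [n] applicants. *)
Definition determined (n : nat) E :=
  forall R R', same_relative_ranks n R R' -> (R \in E) = (R' \in E).

Lemma determinedW m n E : (m <= n)%N -> determined m E -> determined n E.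
Proof.
move=> mn detE R R' /'forall_forallP eqR; apply: detE.
apply/'forall_forallP => j k; apply/implyP => /andP[jm km].
by have /implyP -> // := eqR j k; rewrite !(leq_trans _ mn).
Qed.

Lemma determinedT n : determined n [set: 'S_N].
Proof. by move=> R R' _; rewrite !inE. Qed.

Lemma determinedI n E F :
  determined n E -> determined n F -> determined n (E :&: F).
Proof. by move=> dE dF R R' e; rewrite !inE (dE _ _ e) (dF _ _ e). Qed.

Lemma determinedD n E F :
  determined n E -> determined n F -> determined n (E :\: F).
Proof. by move=> dE dF R R' e; rewrite !inE (dE _ _ e) (dF _ _ e). Qed.

Lemma determined_bigcup n (I : finType) (P : pred I) (A : I -> {set 'S_N}) :
  (forall i, P i -> determined n (A i)) -> determined n (\bigcup_(i | P i) A i).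
Proof.
move=> dA R R' e; apply/bigcupP/bigcupP => -[i Pi Ai]; exists i => //.
  by rewrite -(dA i Pi R R').
by rewrite (dA i Pi R R').
Qed.

Lemma same_relative_ranksC n R R' :
  same_relative_ranks n R R' -> same_relative_ranks n R' R.
Proof.
move=> /'forall_forallP e; apply/'forall_forallP => j k.
by rewrite eq_sym.
Qed.

Lemma same_relative_ranks_le n R R' (j k : 'I_N) :
  same_relative_ranks n R R' -> (j < n)%N -> (k < n)%N ->
  (R j <= R k)%N = (R' j <= R' k)%N.
Proof.
move=> /'forall_forallP e jn kn; have := e k j.
by rewrite jn kn /= => /eqP ekj; rewrite leqNgt ekj -leqNgt.
Qed.

(* Exchanging the ranks v and v+1 does not change the relative order of the
   applicants other than j when j has one of these ranks. *)
Lemma card_rank_at_succ n E (j v v' : 'I_N) :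
    determined n E -> (n <= j)%N -> v' = v.+1 :> nat ->
  #|E :&: [set R : 'S_N | R j == v]| = #|E :&: [set R : 'S_N | R j == v']|.
Proof.
move=> dE nj vv'.
pose f (R : 'S_N) : 'S_N := (R * tperm v v')%g.
have fK : involutive f by move=> R; rewrite /f -mulgA tperm2 mulg1.
have fE R (k : 'I_N) : f R k = (if R k == v then v.+1
    else if R k == v' then val v else R k) :> nat.
  by rewrite /f permM; case: tpermP => [->|->|/eqP/negbTE-> /eqP/negbTE->];
    rewrite ?eqxx -?vv' // -val_eqE /= vv' gtn_eqF.
have same R : (R j == v) || (R j == v') -> same_relative_ranks n R (f R).
  move=> Rj; apply/'forall_forallP => k l; apply/implyP => /andP[kn ln].
  have kj : R k != R j by rewrite (inj_eq perm_inj) -val_eqE /=; lia.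
  have lj : R l != R j by rewrite (inj_eq perm_inj) -val_eqE /=; lia.
  rewrite !fE; move: Rj kj lj; rewrite -!val_eqE /= vv'.
  move: (val (R j)) (val (R k)) (val (R l)) (val v) => a b c d /= ad ba ca.
  by case: (b =P d); case: (b =P d.+1); case: (c =P d); case: (c =P d.+1); lia.
rewrite -(card_imset _ (inv_inj fK)); congr #|pred_of_set _|; apply/setP => R.
rewrite -[R in LHS]fK (mem_imset _ _ (inv_inj fK)) !inE.
have -> : (f R j == v) = (R j == v').
  by rewrite /f permM -[X in _ == X](tpermR v v') (inj_eq perm_inj).
case: (R j =P v') => Rj; last by rewrite !andbF.
by rewrite (dE R (f R)) //; apply: same; rewrite Rj eqxx orbT.
Qed.

(** Exchanging adjacent ranks repeatedly shows that on [E] the [N] possible ranks of the unseen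
    applicant [j] are equally likely. *)
Lemma Pr_best_unseen n E (j : 'I_N) :
    determined n E -> (n <= j)%N ->
  Pr (E :&: [set R : 'S_N | R j == 0%N :> nat]) = Pr E / N%:R.
Proof.
move=> dE nj; have N_gt0 : (0 < N)%N by apply: leq_trans (ltn_ord j).
have eq0 v (vN : (v < N)%N) : #|E :&: [set R : 'S_N | R j == Ordinal vN]|
    = #|E :&: [set R : 'S_N | R j == 0%N :> nat]|.
  elim: v vN => [|v IH] vN; first by congr #|pred_of_set (_ :&: _)|.
  by rewrite -(IH (ltnW vN)); apply/esym; apply: (card_rank_at_succ (n := n)).
have -> : Pr E = \sum_(v : 'I_N) Pr (E :&: [set R : 'S_N | R j == v]).
  apply: Pr_partition => [R ER|v _|R v v'].
  - by exists (R j); rewrite // !inE ER eqxx.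
  - exact: subsetIl.
  - by rewrite !inE => /andP[_ /eqP <-] /andP[_ /eqP].
rewrite (eq_bigr (fun=> Pr (E :&: [set R : 'S_N | R j == 0%N :> nat]))); last first.
  by move=> -[v vN] _; rewrite /Pr eq0.
by rewrite sumr_const card_ord -[_ *+ N]mulr_natr mulfK // pnatr_eq0 -lt0n.
Qed.

(** * Candidates and their independence of the past *)

Section Window.
Variable K : nat.
Hypothesis K_gt0 : (0 < K)%N.

Lemma candidate_event_determined (i : 'I_N) :
  determined (i + K) (candidate_event K i).
Proof.
move=> R R' e; rewrite !inE; apply: eq_forallb => j.
case: ltnP => //= jiK; apply: same_relative_ranks_le e _ jiK; lia.
Qed.

Lemma candidate_best (i : 'I_N) R : R i = 0%N :> nat -> candidate K i R.
Proof. by move=> Ri; apply/forallP => j; rewrite Ri implybT. Qed.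

Lemma candidate_uniq R (i j : 'I_N) :
    candidate K i R -> candidate K j R -> (i <= j < i + K)%N -> i = j.
Proof.
move=> /forallP/(_ j) ci /forallP/(_ i) cj /andP[ij jiK].
apply: (@perm_inj _ R); apply/val_inj/eqP; rewrite eqn_leq /=.
by rewrite (implyP ci jiK) (implyP cj) //; lia.
Qed.

Definition seen (j : nat) : rat := (minn (j + K) N)%:R.

Lemma seen_gt0 (j : 'I_N) : 0 < seen j.
Proof. by rewrite ltr0n; have := ltn_ord j; lia. Qed.

(** On [E] applicant [j] beats everyone seen, so the best applicant is [j] or one of the
    [N - seen j] unseen ones, each of which is best with probability [Pr E / N]. *)
Lemma Pr_candidate_best (j : 'I_N) E :
    determined (j + K) E -> E \subset candidate_event K j ->
  Pr (E :&: [set R : 'S_N | R j == 0%N :> nat]) = seen j / N%:R * Pr E.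
Proof.
move=> dE /subsetP Ecand; have N_gt0 : (0 < N)%N by apply: leq_trans (ltn_ord j).
have N_neq0 : N%:R != 0 :> rat by rewrite pnatr_eq0 -lt0n.
set A := [set R | _].
have -> : Pr (E :&: A) = Pr E - Pr (E :\: A) by rewrite (Pr_setID E A) addrK.
have -> : Pr (E :\: A) = \sum_(k : 'I_N | (j + K <= k)%N)
    Pr (E :&: [set R : 'S_N | R k == 0%N :> nat]).
  apply: Pr_partition => [R||R k k'].
  - rewrite !inE => /andP[Rj ER]; pose k := (R^-1)%g (Ordinal N_gt0).
    have Rk : R k = Ordinal N_gt0 by rewrite permKV.
    exists k; rewrite ?inE ?ER ?Rk //= leqNgt; apply: contra Rj => kjK.
    by have := Ecand _ ER; rewrite inE => /forallP/(_ k)/implyP/(_ kjK); rewrite Rk leqn0.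
  - move=> k jKk; apply/subsetP => R; rewrite !inE => /andP[-> Rk]; rewrite andbT.
    apply/negP => Rj.
    have jk : j = k by apply: (@perm_inj _ R); apply/val_inj; rewrite /= (eqP Rj) (eqP Rk).
    by move: jKk; rewrite jk; lia.
  - rewrite !inE => /andP[_ Rk] /andP[_ Rk'].
    by apply: (@perm_inj _ R); apply/val_inj; rewrite /= (eqP Rk) (eqP Rk').
under eq_bigr => k jKk do rewrite (Pr_best_unseen dE jKk).
rewrite -(big_geq_mkord (j + K) N xpredT (fun=> Pr E / N%:R)) big_const_nat.
rewrite iter_addr_0 -[_ *+ _]mulr_natr /seen.
have -> : (N - (j + K))%:R = N%:R - (minn (j + K) N)%:R :> rat.
  by rewrite -natrB ?geq_minr //; congr _%:R; lia.
by field.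
Qed.

(** The probability that [E] holds and [j] is best is computed twice: by [Pr_best_unseen], and
    through the candidate event by [Pr_candidate_best]. *)
Lemma Pr_candidate j0 E (j : 'I_N) :
    determined j0 E -> (j0 <= j)%N ->
  Pr (E :&: candidate_event K j) = Pr E / seen j.
Proof.
move=> dE jj0; have N_gt0 : (0 < N)%N by apply: leq_trans (ltn_ord j).
have N_neq0 : N%:R != 0 :> rat by rewrite pnatr_eq0 -lt0n.
have := Pr_best_unseen dE jj0; set A := [set R | _] => PrA.
have : Pr (E :&: candidate_event K j :&: A)
    = seen j / N%:R * Pr (E :&: candidate_event K j).
  apply: Pr_candidate_best; last exact: subsetIr.
  apply: determinedI _ (@candidate_event_determined j).
  by apply: determinedW dE; lia.
have -> : E :&: candidate_event K j :&: A = E :&: A.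
  apply/setP => R; rewrite !inE; case: eqP => Rj; rewrite ?andbF // !andbT.
  by rewrite candidate_best ?andbT.
rewrite PrA => /(congr1 (fun x => x * N%:R)) e.
have s0 := lt0r_neq0 (seen_gt0 j).
apply: (mulIf s0); rewrite divfK //; move: e; rewrite divfK // => ->; by field.
Qed.

(** * The dual linear program *)

(* [gain j] is the dual variable of the constraint on x_j (see the header) and
   [value m] the optimal probability of winning with an applicant of index at
   least m.  Since gain j depends on gain l for l >= j + K only, it is computed
   with fuel, N - j being enough. *)
Fixpoint gain_rec (k j : nat) : rat :=
  if k is k'.+1 then
    Num.max 0 (seen j / N%:R - \sum_(l < N | (j + K <= l)%N) gain_rec k' l / seen l)
  else 0.

Definition gain (j : nat) : rat := gain_rec (N - j) j.

Definition value (m : nat) : rat := \sum_(l < N | (m <= l)%N) gain l / seen l.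

Lemma gain_rec_stable k k' j : (j < N)%N -> (N - j <= k)%N -> (N - j <= k')%N ->
  gain_rec k j = gain_rec k' j.
Proof.
elim: k k' j => [|k IH] [|k'] j jN kj k'j; rewrite //=; try lia.
congr (Num.max 0 (_ - _)); apply: eq_bigr => l jKl.
by congr (_ / _); apply: IH; have := ltn_ord l; lia.
Qed.

Lemma gainE (j : 'I_N) : gain j = Num.max 0 (seen j / N%:R - value (j + K)).
Proof.
(* Fuel [N.+1] unfolds once and leaves [N], enough for every index in the sum. *)
rewrite /gain /value (@gain_rec_stable _ N.+1) //=; last by lia.
congr (Num.max 0 (_ - _)); apply: eq_bigr => l jKl.
by congr (_ / _); apply: gain_rec_stable; have := ltn_ord l; lia.
Qed.

Lemma gain_ge0 (j : 'I_N) : 0 <= gain j.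
Proof. by rewrite gainE le_max lexx. Qed.

(** Dual feasibility. *)
Lemma le_gain_value (j : 'I_N) : seen j / N%:R <= gain j + value (j + K).
Proof. by rewrite -lerBlDr gainE le_max lexx orbT. Qed.

Lemma value_ge0 m : 0 <= value m.
Proof.
by apply: sumr_ge0 => l _; rewrite divr_ge0 ?gain_ge0 // ltW ?seen_gt0.
Qed.

Lemma duality (x : 'I_N -> rat) :
  \sum_(j < N) (gain j + value (j + K)) * x j
  = \sum_(j < N) gain j * (x j + (\sum_(l < N | (l + K <= j)%N) x l) / seen j).
Proof.
under eq_bigr do rewrite mulrDl.
under [RHS]eq_bigr do rewrite mulrDr.
rewrite !big_split /=; congr (_ + _).
under eq_bigr do rewrite /value mulr_suml.
rewrite (exchange_big_dep xpredT) //=; apply: eq_bigr => j _.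
by rewrite mulrA mulrAC mulr_sumr.
Qed.

Lemma dual_support n (x : 'I_N -> rat) :
    (forall j : 'I_N, (j < n)%N -> x j = 0) ->
  \sum_(j < N) gain j * (x j + (\sum_(l < N | (l + K <= j)%N) x l) / seen j)
  = \sum_(j < N | (n <= j)%N)
      gain j * (x j + (\sum_(l < N | (l + K <= j)%N) x l) / seen j).
Proof.
move=> x0; rewrite [LHS](bigID (fun j : 'I_N => (n <= j)%N)) /= addrC big1 ?add0r //.
move=> j; rewrite -ltnNge => jn; rewrite x0 // add0r big1 ?mul0r ?mulr0 // => l lKj.
by apply: x0; lia.
Qed.

(** The program of the header has [n = 0] and [g = 1]; general [n] and [g] serve the game resumed at
    [n] on an event of probability [g]. Dual feasibility bounds the objective, and after [duality]
    the primal constraints apply termwise. *)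
Lemma weak_duality n g (x : 'I_N -> rat) :
    (forall j, 0 <= x j) -> (forall j : 'I_N, (j < n)%N -> x j = 0) ->
    (forall j : 'I_N, (n <= j)%N ->
       x j <= (g - \sum_(l < N | (l + K <= j)%N) x l) / seen j) ->
  \sum_(j < N) seen j / N%:R * x j <= value n * g.
Proof.
move=> x_ge0 x0 xle.
apply: (@le_trans _ _ (\sum_(j < N) (gain j + value (j + K)) * x j)).
  by apply: ler_sum => j _; rewrite ler_wpM2r ?le_gain_value.
rewrite duality (dual_support x0) mulr_suml; apply: ler_sum => j nj.
rewrite mulrAC -mulrA ler_wpM2l ?gain_ge0 //.
by have := xle j nj; rewrite mulrBl lerBrDr mulrC.
Qed.

(** Complementary slackness: from [n] on the maximum defining [gain] is its second argument and the
    primal constraints are tight, so both inequalities of [weak_duality] become equalities. *)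
Lemma strong_duality n g (x : 'I_N -> rat) :
    (forall j : 'I_N, (n <= j)%N -> value (j + K) <= seen j / N%:R) ->
    (forall j : 'I_N, (j < n)%N -> x j = 0) ->
    (forall j : 'I_N, (n <= j)%N ->
       x j = (g - \sum_(l < N | (l + K <= j)%N) x l) / seen j) ->
  \sum_(j < N) seen j / N%:R * x j = value n * g.
Proof.
move=> le_seen x0 xE.
transitivity (\sum_(j < N) (gain j + value (j + K)) * x j).
  apply: eq_bigr => j _; case: (ltnP j n) => nj; first by rewrite x0 // !mulr0.
  by congr (_ * _); rewrite gainE max_r ?subrK // subr_ge0 le_seen.
rewrite duality (dual_support x0) mulr_suml; apply: eq_bigr => j nj.
by rewrite mulrAC -mulrA (xE j nj) mulrBl subrK [g / _]mulrC.
Qed.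

(** * Stopping families *)

(* A j is the event that applicant j is chosen and is a candidate: when j is
   chosen without being a candidate the game is lost. *)
Record stopping n G (A : 'I_N -> {set 'S_N}) : Prop := Stopping {
  stopping_candidate : forall j, A j \subset candidate_event K j;
  stopping_determined : forall j : 'I_N, determined (j + K) (A j);
  stopping_disjoint : forall R i j, R \in A i -> R \in A j -> i = j;
  stopping_subset : forall j, A j \subset G;
  stopping_start : forall j : 'I_N, (j < n)%N -> A j = set0
}.

Section StoppingTheory.
Variables (n : nat) (G : {set 'S_N}) (A : 'I_N -> {set 'S_N}).
Hypothesis detG : determined n G.
Hypothesis stopA : stopping n G A.

(** Removing only the stops at [l] with [l + K <= j] keeps the event determined by the applicants
    before [j] (for [n <= j]), so that [Pr_candidate] applies. By [candidate_uniq], stops strictly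
    between [j - K] and [j] cannot occur when [j] is a candidate. *)
Definition unstopped (j : 'I_N) : {set 'S_N} :=
  G :\: \bigcup_(l < N | (l + K <= j)%N) A l.

Lemma Pr_unstopped_candidate (j : 'I_N) : (n <= j)%N ->
  Pr (unstopped j :&: candidate_event K j)
  = (Pr G - \sum_(l < N | (l + K <= j)%N) Pr (A l)) / seen j.
Proof.
move=> nj; rewrite (Pr_candidate (j0 := j)) //; last first.
  apply: determinedD; first exact: determinedW detG.
  apply: determined_bigcup => l lKj; apply: determinedW lKj _.
  exact: stopping_determined stopA l.
congr (_ / _); rewrite /unstopped; set B := \bigcup_(l < N | _) _.
rewrite (Pr_setID G B) -(@Pr_partition _ _ _ (G :&: B)).
- by rewrite addrAC subrr add0r.
- by move=> R; rewrite inE => /andP[_ /bigcupP[l lKj Al]]; exists l.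
- move=> l lKj; rewrite subsetI (stopping_subset stopA) /=.
  exact: (bigcup_sup l).
- exact: stopping_disjoint stopA.
Qed.

Lemma stopping_sub_unstopped (j : 'I_N) :
  A j \subset unstopped j :&: candidate_event K j.
Proof.
rewrite subsetI (stopping_candidate stopA) andbT; apply/subsetP => R Aj.
rewrite inE (subsetP (stopping_subset stopA j)) // andbT.
apply/bigcupP => -[l lKj /(stopping_disjoint stopA Aj) jl].
by move: lKj; rewrite jl; lia.
Qed.

Lemma Pr_stopping_best (j : 'I_N) :
  Pr (A j :&: [set R : 'S_N | R j == 0%N :> nat]) = seen j / N%:R * Pr (A j).
Proof.
apply: Pr_candidate_best (stopping_candidate stopA j).
exact: stopping_determined stopA j.
Qed.

Lemma stopping_value_le :
  \sum_(j < N) Pr (A j :&: [set R : 'S_N | R j == 0%N :> nat]) <= value n * Pr G.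
Proof.
under eq_bigr do rewrite Pr_stopping_best.
apply: weak_duality => [j|j jn|j nj]; first exact: Pr_ge0.
  by rewrite (stopping_start stopA jn) Pr_set0.
rewrite -Pr_unstopped_candidate //; apply: Pr_subset.
exact: stopping_sub_unstopped.
Qed.

Lemma stopping_value_eq :
    (forall j : 'I_N, (n <= j)%N -> value (j + K) <= seen j / N%:R) ->
    (forall j : 'I_N, (n <= j)%N -> unstopped j :&: candidate_event K j \subset A j) ->
  \sum_(j < N) Pr (A j :&: [set R : 'S_N | R j == 0%N :> nat]) = value n * Pr G.
Proof.
move=> le_seen greedy.
under eq_bigr do rewrite Pr_stopping_best.
apply: strong_duality => // [j jn|j nj].
  by rewrite (stopping_start stopA jn) Pr_set0.
rewrite -Pr_unstopped_candidate //; congr Pr; apply/eqP; rewrite eqEsubset greedy //.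
by rewrite stopping_sub_unstopped.
Qed.
End StoppingTheory.

(** * Strategies as stopping families *)

Lemma ohead_pmapP (T : eqType) (S : Type) (f : T -> option S) (lt : rel T) s a :
    irreflexive lt -> transitive lt -> sorted lt s ->
  ohead (pmap f s) = Some a <->
  exists x, [/\ x \in s, f x = Some a & forall y, y \in s -> lt y x -> f y = None].
Proof.
move=> ltxx lt_tr; elim: s => [|x s IH] /=; first by split=> // -[x []].
move=> xs; have /allP xmin := order_path_min lt_tr xs.
have {IH} := IH (path_sorted xs); case fx: (f x) => [b|] /= IH; split.
- move=> [<-]; exists x; split=> //; first by rewrite mem_head.
  move=> y; rewrite inE => /predU1P[->|/xmin xy]; rewrite ?ltxx // => yx.
  by have := lt_tr _ _ _ xy yx; rewrite ltxx.
- move=> [y []]; rewrite inE => /predU1P[->|/xmin xy] fy none.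
    by rewrite -fy fx.
  by have := none x (mem_head _ _) xy; rewrite fx.
- move=> /IH[y [ys fy none]]; exists y; split=> // [|z]; first by rewrite inE ys orbT.
  by rewrite inE => /predU1P[-> //|]; apply: none.
- move=> [y []]; rewrite inE => /predU1P[->|ys] fy none; first by rewrite fx in fy.
  apply/IH; exists y; split=> // z zs; apply: none; by rewrite inE zs orbT.
Qed.

Lemma chosenP (s : strategy N) (w0 : nat) R (j : 'I_N) :
  chosen s w0 R = Some j <->
  exists w : 'I_N, [/\ (w0 <= w)%N, s w R = Some j &
    forall w' : 'I_N, (w0 <= w')%N -> (w' < w)%N -> s w' R = None].
Proof.
pose lt : rel 'I_N := fun i k => (i < k)%N.
have lt_tr : transitive lt by move=> ? ? ?; apply: ltn_trans.
have ltxx : irreflexive lt by move=> ?; apply: ltnn.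
have srt : sorted lt [seq w : 'I_N <- enum 'I_N | (w0 <= w)%N].
  apply: sorted_filter => //.
  by have := iota_ltn_sorted 0 N; rewrite -val_enum_ord sorted_map.
rewrite /chosen (ohead_pmapP _ _ ltxx lt_tr srt).
split=> -[w [ww sw none]]; exists w; split=> //.
- by move: ww; rewrite mem_filter => /andP[].
- by move=> w' w0w'; apply: none; rewrite mem_filter w0w' mem_enum.
- by rewrite mem_filter ww mem_enum.
- by move=> w'; rewrite mem_filter => /andP[w0w' _]; apply: none.
Qed.

(** Applicant [j] is chosen from a window starting at some [w <= j], and all decisions up to then
    see only applicants before [w + K <= j + K]. *)
Lemma chosen_determined (s : strategy N) w0 (j : 'I_N) :
  admissible K s -> determined (j + K) [set R | chosen s w0 R == Some j].
Proof.
move=> /'forall_forallP adm.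
suff sub R R' : same_relative_ranks (j + K) R R' ->
    chosen s w0 R = Some j -> chosen s w0 R' = Some j.
  move=> R R' e; rewrite !inE; apply/eqP/eqP; apply: sub => //.
  exact: same_relative_ranksC.
move=> /'forall_forallP e /chosenP[w [w0w swj none]]; apply/chosenP.
have wj : (w <= j)%N by have /andP[] := adm w R; rewrite swj => /andP[].
have same (v : 'I_N) : (v <= w)%N -> s v R = s v R'.
  move=> vw; have /andP[_ /forallP/(_ R')/implyP h] := adm v R.
  apply/eqP/h/'forall_forallP => k l; apply/implyP => /andP[kv lv].
  by have /implyP := e k l; apply; lia.
exists w; split=> // [|v w0v vw]; first by rewrite -same.
by rewrite -same ?none //; lia.
Qed.

Lemma chosen_ge (s : strategy N) w0 R (j : 'I_N) :
  admissible K s -> chosen s w0 R = Some j -> (w0 <= j)%N.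
Proof.
move=> /'forall_forallP adm /chosenP[w [w0w swj _]].
by have := adm w R; rewrite swj => /andP[/andP[wj _] _]; lia.
Qed.

Definition chosen_candidate (s : strategy N) (w0 : nat) G (j : 'I_N) : {set 'S_N} :=
  [set R | chosen s w0 R == Some j] :&: candidate_event K j :&: G.

Lemma Pr_win_chosen (s : strategy N) w0 G :
  Pr (win s w0 :&: G)
  = \sum_(j < N) Pr (chosen_candidate s w0 G j :&: [set R : 'S_N | R j == 0%N :> nat]).
Proof.
apply: Pr_partition => [R|j _|R j j'].
- rewrite !inE; case e: (chosen s w0 R) => [j|] // /andP[Rj GR].
  by exists j; rewrite // !inE e eqxx GR Rj candidate_best //; apply/eqP.
- by apply/subsetP => R; rewrite !inE => /andP[/andP[/andP[/eqP -> _] ->] ->].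
- by rewrite !inE => /andP[/andP[/andP[/eqP -> _] _] _] /andP[/andP[/andP[/eqP[]]]].
Qed.

Lemma chosen_candidate_stopping (s : strategy N) w0 n G :
    admissible K s -> determined n G ->
    (forall (j : 'I_N) R, (j < n)%N -> R \notin chosen_candidate s w0 G j) ->
  stopping n G (chosen_candidate s w0 G).
Proof.
move=> adm detG start.
have start0 (j : 'I_N) : (j < n)%N -> chosen_candidate s w0 G j = set0.
  by move=> jn; apply/setP => R; rewrite in_set0; apply/negbTE/start.
split=> // [j|j|R i j|j].
- by apply/subsetP => R; rewrite 2!inE => /andP[/andP[_ ->]].
(* For [j < n] the event [G] may depend on applicants not yet seen from [j], but then the set is
   empty. *)
- case: (ltnP j n) => [/start0 ->|nj]; first by move=> R R'; rewrite !inE.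
  apply: determinedI; last by apply: determinedW detG; lia.
  by apply: determinedI; [apply: chosen_determined | apply: candidate_event_determined].
- by rewrite !inE => /andP[/andP[/eqP -> _] _] /andP[/andP[/eqP[]]].
- exact: subsetIr.
Qed.

Lemma threshold_admissible d : admissible K (threshold_strategy N K d).
Proof.
apply/'forall_forallP => w R; apply/andP; split.
  by rewrite !ffunE; case: ifP => // _; lia.
apply/forallP => R'; apply/implyP => e; rewrite !ffunE.
by have := candidate_event_determined e; rewrite !inE => ->.
Qed.

Lemma threshold_chosenP d w0 R (j : 'I_N) : (w0 <= d)%N ->
  chosen (threshold_strategy N K d) w0 R = Some j <->
  [/\ (d <= j)%N, candidate K j R &
    forall l : 'I_N, (d <= l < j)%N -> ~~ candidate K l R].
Proof.
move=> w0d; split=> [/chosenP[w [w0w]]|[dj cj none]].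
  rewrite !ffunE; case: ifP => // /andP[dw cw] [<-] none; split=> // l /andP[dl lw].
  have := none l; rewrite !ffunE dl /=; case: ifP => // _ H.
  by have : Some l = None by apply: H; lia.
apply/chosenP; exists j; rewrite !ffunE dj cj; split=> //; first by lia.
move=> l w0l lj; rewrite !ffunE; case: ifP => // /andP[dl cl].
by have := none l; rewrite dl lj cl => /(_ isT).
Qed.

Lemma Pr_win_threshold n w0 G : (w0 <= n)%N -> determined n G ->
    (forall j : 'I_N, (n <= j)%N -> value (j + K) <= seen j / N%:R) ->
  Pr (win (threshold_strategy N K n) w0 :&: G) = value n * Pr G.
Proof.
move=> w0n detG le_seen; rewrite Pr_win_chosen; apply: stopping_value_eq => //.
  apply: chosen_candidate_stopping => //; first exact: threshold_admissible.
  move=> j R jn; rewrite !inE; apply/negP => /andP[/andP[/eqP]].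
  by move=> /(threshold_chosenP _ _ w0n)[]; lia.
move=> j nj; apply/subsetP => R; rewrite !inE => /andP[/andP[none GR] cj].
rewrite GR cj !andbT; apply/eqP/threshold_chosenP => //; split=> // l nlj.
apply/negP => cl.
(* The first candidate [m] in [[n, j)] would be chosen; [candidate_uniq] forces [m + K <= j],
   against the assumption that nothing was chosen by then. *)
have [m /andP[nmj cm] m_min] := arg_minnP (fun k : 'I_N => val k)
  (P := fun k : 'I_N => (n <= k < j)%N && candidate K k R) (introT andP (conj nlj cl)).
case/negP: none; apply/bigcupP; exists m.
  rewrite leqNgt; apply/negP => jmK.
  by have : m = j; [apply: candidate_uniq cm cj _ | move=> mj; move: nmj; rewrite mj]; lia.
rewrite !inE GR cm !andbT; apply/eqP/threshold_chosenP => //; split=> //; first by lia.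
move=> k nkm; apply/negP => ck.
by have := m_min k; rewrite ck andbT /= => /(_ _); lia.
Qed.

Lemma Pr_candidate_event_gt0 (i : 'I_N) : 0 < Pr (candidate_event K i).
Proof.
rewrite -[candidate_event K i]setTI (Pr_candidate (@determinedT 0)) // Pr_setT.
by rewrite divr_gt0 ?seen_gt0.
Qed.

Lemma Pr_win_choosingE (i : 'I_N) : Pr_win_choosing K i = seen i / N%:R.
Proof.
rewrite /Pr_win_choosing /condPr setIC Pr_candidate_best //.
  by rewrite mulfK // gt_eqF ?Pr_candidate_event_gt0.
exact: candidate_event_determined.
Qed.

(** When [i] is a candidate, no index strictly between [i] and [i + K] is one, so the game
    effectively resumes at [i + K] rather than at [i.+1]. *)
Lemma Pr_win_rejecting_le (i : 'I_N) : Pr_win_rejecting K i <= value (i + K).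
Proof.
apply/bigmax_leP; split=> [|s adm]; first exact: value_ge0.
rewrite /condPr ler_pdivrMr ?Pr_candidate_event_gt0 // Pr_win_chosen.
apply: stopping_value_le; first exact: candidate_event_determined.
apply: chosen_candidate_stopping => //; first exact: candidate_event_determined.
move=> j R jiK; rewrite !inE; apply/negP => /andP[/andP[/eqP /(chosen_ge adm) ij cj] ci].
by have e : i = j; [apply: candidate_uniq ci cj _ | move: ij; rewrite e]; lia.
Qed.

Lemma Pr_win_rejecting_ge n (i : 'I_N) : (i + K <= n)%N ->
    (forall j : 'I_N, (n <= j)%N -> value (j + K) <= seen j / N%:R) ->
  value n <= Pr_win_rejecting K i.
Proof.
move=> iKn le_seen; apply: (bigmax_sup (threshold_strategy N K n)).
  exact: threshold_admissible.
rewrite /condPr Pr_win_threshold //; last 2 first.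
- by lia.
- by apply: determinedW (@candidate_event_determined i).
by rewrite mulfK // gt_eqF ?Pr_candidate_event_gt0.
Qed.

Lemma Pr_win_le_value d : Pr_win N K d <= value 0.
Proof.
rewrite /Pr_win -[win _ _]setIT Pr_win_chosen -[value 0]mulr1 -Pr_setT.
apply: stopping_value_le; first exact: determinedT.
apply: chosen_candidate_stopping => //; first exact: threshold_admissible.
exact: determinedT.
Qed.

(** * Optimality of the threshold strategy *)

Section OptimalThreshold.
Variable d : 'I_N.
Hypothesis opt : optimal_threshold K d.

(** Backward induction: the bound at later indices lets threshold [j + K] attain [value (j + K)],
    also after rejecting [d]. Hence [value (j + K)] is at most the rejection value at [d], which is
    below [seen d / N], and [seen] is nondecreasing. *)
Lemma value_le_seen (j : 'I_N) : (d <= j)%N -> value (j + K) <= seen j / N%:R.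
Proof.
have [m] := ubnP (N - j); elim: m j => // m IH j jm dj; have jN := ltn_ord j.
have [gt _] := opt; rewrite Pr_win_choosingE in gt.
apply: (@le_trans _ _ (Pr_win_rejecting K d)).
  by apply: Pr_win_rejecting_ge => [|l jl]; [lia | apply: IH; lia].
apply: (le_trans (ltW gt)); rewrite ler_wpM2r ?invr_ge0 // ler_nat; lia.
Qed.

Lemma Pr_win_optimal : Pr_win N K d = value 0.
Proof.
rewrite /Pr_win -[win _ _]setIT Pr_win_threshold //; first last.
- exact: value_le_seen.
- exact: determinedT.
(* By minimality of [d], rejecting is at least as good as choosing at each [j < d], so [gain j]
   vanishes there and [value d = value 0]. *)
rewrite Pr_setT mulr1 /value [RHS](bigID (fun j : 'I_N => (d <= j)%N)) /=.
rewrite [X in _ = _ + X]big1 ?addr0 // => j; rewrite -ltnNge => jd.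
rewrite gainE max_l ?mul0r // subr_le0; apply: le_trans (Pr_win_rejecting_le j).
rewrite -Pr_win_choosingE leNgt; apply/negP => /(proj2 opt); lia.
Qed.

Lemma Pr_win_le_optimal d' : Pr_win N K d' <= Pr_win N K d.
Proof. by rewrite Pr_win_optimal Pr_win_le_value. Qed.

End OptimalThreshold.

Lemma win_thresholdP d R :
  reflect (exists j : 'I_N, [/\ (d <= j)%N, R j = 0%N :> nat &
      forall l : 'I_N, (d <= l < j)%N -> ~~ candidate K l R])
    (R \in win (threshold_strategy N K d) 0).
Proof.
apply: (iffP idP); rewrite inE.
  case e: (chosen _ _ _) => [j|] // /eqP Rj; exists j.
  by move: e => /threshold_chosenP[].
move=> [j [dj Rj none]].
have -> : chosen (threshold_strategy N K d) 0 R = Some j.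
  by apply/threshold_chosenP; rewrite ?candidate_best.
exact/eqP.
Qed.
End Window.

(** * Comparison of two window sizes *)

Lemma rank_two (i j : 'I_N) : i != j ->
  exists R : 'S_N, R i = 0%N :> nat /\ R j = 1%N :> nat.
Proof.
rewrite -val_eqE /= => ij; have iN := ltn_ord i; have jN := ltn_ord j.
have N_gt0 : (0 < N)%N by lia.
have N_gt1 : (1 < N)%N by lia.
pose t := tperm i (Ordinal N_gt0).
exists (t * tperm (t j) (Ordinal N_gt1))%g; rewrite !permM [tperm (t j) _ (t j)]tpermL.
have ti : t i = Ordinal N_gt0 by apply: tpermL.
by rewrite tpermD // ti // -ti (inj_eq perm_inj) eq_sym -val_eqE.
Qed.

Lemma Pr_win_lt_window kappa K d : (0 < kappa < K)%N -> (K <= N)%N ->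
  exists d', Pr_win N kappa d < Pr_win N K d'.
Proof.
move=> /andP[k_gt0 kK] KN; have K_gt0 : (0 < K)%N by lia.
case: (ltnP (d + kappa) N) => dkN.
- have dN : (d < N)%N by lia.
  pose a := Ordinal dN; pose m := Ordinal dkN.
  exists d; apply/Pr_proper/properP; split.
    apply/subsetP => R /(win_thresholdP k_gt0)[j [dj Rj none]].
    apply/(win_thresholdP K_gt0); exists j; split=> // l dlj.
    apply: contra (none l dlj) => /forallP cl; apply/forallP => i.
    by apply/implyP => ilk; apply: (implyP (cl i)); lia.
  have am : m != a by rewrite -val_eqE /=; lia.
  (* With the best applicant at [d + kappa] and the second best at [d], window [kappa] at [d] just
     misses the best and raises a false alarm. Window [K] reaches it, and the second best rules out
     all candidates strictly in between. *)
  have [R [Rm Ra]] := rank_two am; exists R.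
    apply/(win_thresholdP K_gt0); exists m; split=> //=; first by lia.
    move=> l dlm; apply/negP => /forallP cl.
    case: (l =P a) => [la|/eqP la].
      by have := cl m; rewrite la Ra Rm /= implybF ltn_add2l kK.
    have aK : (a < l + K)%N by move: dlm; rewrite /=; lia.
    have := implyP (cl a) aK; rewrite Ra.
    have lm : l != m by rewrite -val_eqE /=; lia.
    have : R l != R m by rewrite (inj_eq perm_inj).
    have : R l != R a by rewrite (inj_eq perm_inj).
    by rewrite -!val_eqE /= Ra Rm; case: (val (R l)) => [|[]].
  apply/(win_thresholdP k_gt0) => -[j [dj Rj none]].
  have jm : j = m by apply: (@perm_inj _ R); apply/val_inj; rewrite /= Rj Rm.
  have := none a; rewrite jm /= => /(_ _)/negP[]; first by lia.
  apply/forallP => l; apply/implyP => lk; rewrite Ra lt0n; apply: contraL lk => /eqP Rl.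
  have -> : l = m by apply: (@perm_inj _ R); apply/val_inj; rewrite /= Rl Rm.
  by rewrite /= ltnn.
- have NKN : (N - K < N)%N by lia.
  pose a := Ordinal NKN; pose o := Ordinal (leq_trans K_gt0 KN).
  exists (N - K)%N; apply/Pr_proper/properP; split.
    apply/subsetP => R /(win_thresholdP k_gt0)[j [dj Rj _]].
    apply/(win_thresholdP K_gt0); exists j; split=> // [|l lj]; first by lia.
    apply/negP => /forallP/(_ j)/implyP; rewrite Rj leqn0 => /(_ _)/eqP Rl.
    have : l = j.
      by apply: (@perm_inj _ R); apply/val_inj; rewrite /= Rj Rl //; have := ltn_ord j; lia.
    by move=> e; move: lj; rewrite e; lia.
  (* The best applicant sits at [N - K], which threshold [d] skips. *)
  exists (tperm a o).
    apply/(win_thresholdP K_gt0); exists a; rewrite tpermL; split=> //= l; lia.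
  apply/(win_thresholdP k_gt0) => -[j [dj Rj _]].
  have ja : j = a by apply: (@perm_inj _ (tperm a o)); apply/val_inj; rewrite /= Rj tpermL.
  by move: dj; rewrite ja /=; lia.
Qed.
End Probability.

Theorem lemma3p2 (N kappa K : nat) (dkappa dK : 'I_N)
    (kappa_ge1 : (1 <= kappa)%N) (kappa_lt_K : (kappa < K)%N)
    (K_le_N : (K <= N)%N)
    (opt_kappa : optimal_threshold kappa dkappa)
    (opt_K : optimal_threshold K dK) :
  Pr_win N kappa dkappa < Pr_win N K dK.
Proof.
have kK : (0 < kappa < K)%N by rewrite kappa_ge1.
have [d lt_d] := Pr_win_lt_window dkappa kK K_le_N.
apply: lt_le_trans lt_d (Pr_win_le_optimal _ opt_K d).
exact: leq_trans kappa_lt_K.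
Qed.
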